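(* Let $k$ be a commutative ring, $G$ a group and $R$ a $G$-algebra. Then $R$ is principal (i.e. $R\cong\bar A$ as $G$-algebras for some $G$-graded $k$-algebra $A$) if and only if there is a group monomorphism $\mathcal T:G\hookrightarrow \mathrm{Aut}_*(R)$, $g\mapsto\mathcal T_g$, such that for every $g\in G$, $\mathcal T_g$ has left degree $g$. In particular, a $\mathbb Z$-algebra $R$ is principal if and only if $R$ has a $k$-algebra automorphism of degree $1$.
   Context: A $G$-algebra is a $k$-algebra $R$ (possibly without $1$) with $R=\bigoplus_{f,g\in G}R_{f,g}$ as $k$-modules, such that $R_{f,g}R_{g,h}\subseteq R_{f,h}$, $R_{f,g}R_{g',h}=0$ if $g\neq g'$, and each $R_{f,f}$ has an element $1_f$ acting as a right identity on every $R_{g,f}$ and a left identity on every $R_{f,g}$; a $\mathbb Z$-algebra is a $G$-algebra with $G=\mathbb Z$. Two $G$-algebras are isomorphic as $G$-algebras if there is a $k$-algebra isomorphism sending $1_f$ to $1_f$ for all $f$. A $k$-algebra (or $k$-module) map $\psi:R\to S$ of $G$-algebras is graded of (left) degree $h$ if $\psi(R_{f,g})\subseteq S_{hf,hg}$ for all $f,g$. $\mathrm{Aut}_*(R)$ denotes the group of $k$-algebra automorphisms of $R$ that are graded of left degree $g$ for some $g\in G$. For a $G$-graded $k$-algebra $A$, $\bar A$ is the $G$-algebra with $\bar A_{f,g}=A_{f^{-1}g}$ and multiplication induced from $A$. *)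

(* Defs.v *)
From HB Require Import structures.
From mathcomp Require Import all_boot all_order all_algebra.
From mathcomp Require Import monoid.
Set Implicit Arguments. Unset Strict Implicit. Unset Printing Implicit Defensive.
Import Order.TTheory GRing.Theory Num.Theory.
Local Open Scope ring_scope.

Section GAlgebras.
Variables (k : comPzRingType) (G : groupType).

Definition is_kalg_nonunital (R : lmodType k) (mul : R -> R -> R) : Prop :=
  [/\ (forall x y z, mul (x + y) z = mul x z + mul y z),
      (forall x y z, mul x (y + z) = mul x y + mul x z),
      (forall (a : k) x y, mul (a *: x) y = a *: mul x y),
      (forall (a : k) x y, mul x (a *: y) = a *: mul x y) &
      (forall x y z, mul x (mul y z) = mul (mul x y) z)].

Definition is_submod (R : lmodType k) (P : pred R) : Prop :=
  [/\ 0 \in P, (forall x y, x \in P -> y \in P -> x + y \in P) &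
      (forall (a : k) x, x \in P -> a *: x \in P)].

Definition is_direct_sum (I : eqType) (R : lmodType k) (P : I -> pred R) : Prop :=
  (forall x : R, exists (s : seq I) (y : I -> R),
      (forall i, i \in s -> y i \in P i) /\ x = \sum_(i <- s) y i) /\
  (forall (s : seq I) (y : I -> R), uniq s ->
      (forall i, i \in s -> y i \in P i) ->
      \sum_(i <- s) y i = 0 -> forall i, i \in s -> y i = 0).

(* A G-algebra: a k-algebra R (possibly without 1) with product [mul],
   R = (+)_{f,g} R_{f,g} (R_{f,g} = [C f g]) as k-modules,
   R_{f,g} R_{g,h} <= R_{f,h}, R_{f,g} R_{g',h} = 0 for g <> g',
   and [one f] = 1_f in R_{f,f} is a right identity on every R_{g,f} and a
   left identity on every R_{f,g}. *)
Definition is_Galgebra (R : lmodType k) (mul : R -> R -> R)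
    (C : G -> G -> pred R) (one : G -> R) : Prop :=
  is_kalg_nonunital mul /\
  (forall f g, is_submod (C f g)) /\
  is_direct_sum (fun p : G * G => C p.1 p.2) /\
  (forall f g h x y, x \in C f g -> y \in C g h -> mul x y \in C f h) /\
  (forall f g g' h x y, g != g' -> x \in C f g -> y \in C g' h -> mul x y = 0) /\
  (forall f, one f \in C f f /\
     (forall g x, x \in C g f -> mul x (one f) = x) /\
     (forall g x, x \in C f g -> mul (one f) x = x)).

(* k-algebra homomorphism (no unit condition: R need not have 1). *)
Definition is_kalg_morph (R S : lmodType k) (mulR : R -> R -> R)
    (mulS : S -> S -> S) (psi : R -> S) : Prop :=
  [/\ (forall x y, psi (x + y) = psi x + psi y),
      (forall (a : k) x, psi (a *: x) = a *: psi x) &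
      (forall x y, psi (mulR x y) = mulS (psi x) (psi y))].

Definition is_kalg_aut (R : lmodType k) (mulR : R -> R -> R) (psi : R -> R) : Prop :=
  is_kalg_morph mulR mulR psi /\ bijective psi.

Definition graded_of_degree (R S : lmodType k) (CR : G -> G -> pred R)
    (CS : G -> G -> pred S) (psi : R -> S) (h : G) : Prop :=
  forall f g x, x \in CR f g -> psi x \in CS (h * f)%g (h * g)%g.

Definition is_kalg (A : lmodType k) (mul : A -> A -> A) (one : A) : Prop :=
  [/\ is_kalg_nonunital mul, (forall x, mul one x = x) & (forall x, mul x one = x)].

Definition is_Ggraded_kalg (A : lmodType k) (mul : A -> A -> A) (one : A)
    (Ag : G -> pred A) : Prop :=
  [/\ is_kalg mul one, (forall g, is_submod (Ag g)), is_direct_sum Ag &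
      (forall g h x y, x \in Ag g -> y \in Ag h -> mul x y \in Ag (g * h)%g)].

(* Elements of \bar A = (+)_{f,g} \bar A_{f,g}, \bar A_{f,g} = A_{f^-1 g},
   represented as finitely supported families (z f g)_{f,g}. *)
Definition in_bar (A : lmodType k) (Ag : G -> pred A) (z : G -> G -> A) : Prop :=
  (exists s : seq (G * G), forall f g, (f, g) \notin s -> z f g = 0) /\
  (forall f g, z f g \in Ag (f^-1 * g)%g).

(* R is isomorphic as a G-algebra to \bar A, via phi : R -> \bar A:
   phi is a k-linear bijection onto \bar A, multiplicative for the product
   of \bar A (induced from A: (z z')_{f,h} = sum_g z_{f,g} z'_{g,h}), and
   sends 1_f to the unit 1_f of \bar A (1_A placed in slot (f,f)). *)
Definition Galg_iso_bar (R : lmodType k) (mulR : R -> R -> R)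
    (oneR : G -> R) (A : lmodType k) (mulA : A -> A -> A) (oneA : A)
    (Ag : G -> pred A) (phi : R -> G -> G -> A) : Prop :=
  (forall x y f g, phi (x + y) f g = phi x f g + phi y f g) /\
  (forall (a : k) x f g, phi (a *: x) f g = a *: phi x f g) /\
  (forall x y, (forall f g, phi x f g = phi y f g) -> x = y) /\
  (forall x, in_bar Ag (phi x)) /\
  (forall z, in_bar Ag z -> exists x, forall f g, phi x f g = z f g) /\
  (forall x y f h (s : seq G), uniq s ->
      (forall g, g \notin s -> phi x f g = 0) ->
      phi (mulR x y) f h = \sum_(g <- s) mulA (phi x f g) (phi y g h)) /\
  (forall f f' g', phi (oneR f) f' g' =
      if (f' == f) && (g' == f) then oneA else 0).

Definition principal (R : lmodType k) (mulR : R -> R -> R) (oneR : G -> R) : Prop :=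
  exists (A : lmodType k) (mulA : A -> A -> A) (oneA : A) (Ag : G -> pred A),
    is_Ggraded_kalg mulA oneA Ag /\
    exists phi : R -> G -> G -> A, Galg_iso_bar mulR oneR mulA oneA Ag phi.

End GAlgebras.

Definition Zgrp : Type := int.
HB.instance Definition _ := Choice.copy Zgrp int.
HB.instance Definition _ := isGroup.Build Zgrp
  (@addrA int) (@add0r int) (@addr0 int) (@addNr int) (@subrr int).
(* the integer 1, as an element of Zgrp (its group "1" is the integer 0) *)
Definition Zgrp_one : Zgrp := (1%:Z : int).

(* Main.v *)
Require Import Defs.
From HB Require Import structures.
From mathcomp Require Import all_boot all_order all_algebra.
From mathcomp Require Import monoid.
From Stdlib Require Import ClassicalEpsilon.
Import GRing.Theory.
Local Open Scope ring_scope.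

Set Implicit Arguments. Unset Strict Implicit.

(* Given phi : R ~= \bar A, shifting the indices of \bar A by g,
   (z_{f,h}) |-> (z_{g^-1 f, g^-1 h}), is an automorphism of degree g; transported
   to R it gives T_g, and g |-> T_g is injective once R <> 0 because a nonzero
   homogeneous element determines the degree of a graded map.  Conversely, given
   T, let A := 1_1 R = (+)_g R_{1,g}, graded by A_g := R_{1,g}, with the product
   a * b := sum_g a_{1,g} T_g(b) and unit 1_1; then x |-> (T_{f^-1}(x_{f,g}))_{f,g}
   is an isomorphism R ~= \bar A.  For G = Z one takes T_n := psi^n. *)

Section BigSeq.
Variables (V : zmodType) (I : eqType).

Lemma sum_seq_delta (s : seq I) (F : I -> V) j : uniq s ->
  \sum_(i <- s) (if i == j then F i else 0) = if j \in s then F j else 0.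
Proof.
elim: s => [|a s IH] /=; first by rewrite big_nil.
case/andP=> nas us; rewrite big_cons IH // in_cons.
have [<-|ne] := eqVneq a j; first by rewrite (negbTE nas) addr0.
by rewrite add0r.
Qed.

Lemma sum_supported_eq (s t : seq I) (F : I -> V) : uniq s -> uniq t ->
  (forall i, i \notin s -> F i = 0) -> (forall i, i \notin t -> F i = 0) ->
  \sum_(i <- s) F i = \sum_(i <- t) F i.
Proof.
move=> us ut Fs Ft; apply: perm_big_supp; apply: uniq_perm; rewrite ?filter_uniq //.
move=> i; rewrite !mem_filter; have [//|nz] /= := eqVneq (F i) 0.
by rewrite (contra_neqT (Fs i) nz) (contra_neqT (Ft i) nz).
Qed.

End BigSeq.

Section NonunitalAlgebra.
Variables (k : comPzRingType) (R : lmodType k) (mul : R -> R -> R).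
Hypothesis Hmul : is_kalg_nonunital mul.

Lemma kalg_mulDl x y z : mul (x + y) z = mul x z + mul y z.
Proof. by case: Hmul. Qed.
Lemma kalg_mulDr x y z : mul x (y + z) = mul x y + mul x z.
Proof. by case: Hmul. Qed.
Lemma kalg_mulZl a x y : mul (a *: x) y = a *: mul x y.
Proof. by case: Hmul. Qed.
Lemma kalg_mulZr a x y : mul x (a *: y) = a *: mul x y.
Proof. by case: Hmul. Qed.
Lemma kalg_mulA x y z : mul x (mul y z) = mul (mul x y) z.
Proof. by case: Hmul. Qed.
Lemma kalg_mul0l y : mul 0 y = 0.
Proof. by rewrite -(scale0r 0) kalg_mulZl !scale0r. Qed.
Lemma kalg_mul0r x : mul x 0 = 0.
Proof. by rewrite -(scale0r 0) kalg_mulZr !scale0r. Qed.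
Lemma kalg_mul_suml (J : Type) (s : seq J) (F : J -> R) y :
  mul (\sum_(j <- s) F j) y = \sum_(j <- s) mul (F j) y.
Proof.
elim: s => [|a s IH]; first by rewrite !big_nil kalg_mul0l.
by rewrite !big_cons kalg_mulDl IH.
Qed.
Lemma kalg_mul_sumr (J : Type) (s : seq J) (F : J -> R) x :
  mul x (\sum_(j <- s) F j) = \sum_(j <- s) mul x (F j).
Proof.
elim: s => [|a s IH]; first by rewrite !big_nil kalg_mul0r.
by rewrite !big_cons kalg_mulDr IH.
Qed.

End NonunitalAlgebra.

Section Submodule.
Variables (k : comPzRingType) (R : lmodType k) (P : pred R).
Hypothesis HP : is_submod P.

Lemma submod0 : 0 \in P.
Proof. by case: HP. Qed.
Lemma submodD x y : x \in P -> y \in P -> x + y \in P.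
Proof. by case: HP => _ + _; apply. Qed.
Lemma submodZ a x : x \in P -> a *: x \in P.
Proof. by case: HP => _ _; apply. Qed.
Lemma submod_sum (J : Type) (s : seq J) (F : J -> R) :
  (forall j, F j \in P) -> \sum_(j <- s) F j \in P.
Proof.
move=> FP; elim: s => [|a s IH]; first by rewrite big_nil submod0.
by rewrite big_cons submodD.
Qed.

End Submodule.

Section Morphism.
Variables (k : comPzRingType) (R S : lmodType k).
Variables (mulR : R -> R -> R) (mulS : S -> S -> S) (psi : R -> S).
Hypothesis Hpsi : is_kalg_morph mulR mulS psi.

Lemma kmorphD x y : psi (x + y) = psi x + psi y.
Proof. by case: Hpsi. Qed.
Lemma kmorphZ a x : psi (a *: x) = a *: psi x.
Proof. by case: Hpsi. Qed.
Lemma kmorphM x y : psi (mulR x y) = mulS (psi x) (psi y).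
Proof. by case: Hpsi. Qed.
Lemma kmorph0 : psi 0 = 0.
Proof. by rewrite -(scale0r 0) kmorphZ !scale0r. Qed.
Lemma kmorph_sum (J : Type) (s : seq J) (F : J -> R) :
  psi (\sum_(j <- s) F j) = \sum_(j <- s) psi (F j).
Proof.
elim: s => [|a s IH]; first by rewrite !big_nil kmorph0.
by rewrite !big_cons kmorphD IH.
Qed.

Lemma kalg_morph_can psi' : cancel psi psi' -> cancel psi' psi ->
  is_kalg_morph mulS mulR psi'.
Proof.
move=> K1 K2; split=> [x y|a x|x y]; apply: (can_inj K1).
- by rewrite kmorphD !K2.
- by rewrite kmorphZ !K2.
- by rewrite kmorphM !K2.
Qed.

End Morphism.

Lemma kalg_morph_comp (k : comPzRingType) (R S U : lmodType k)
    (mulR : R -> R -> R) (mulS : S -> S -> S) (mulU : U -> U -> U)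
    (phi : S -> U) (psi : R -> S) :
  is_kalg_morph mulS mulU phi -> is_kalg_morph mulR mulS psi ->
  is_kalg_morph mulR mulU (phi \o psi).
Proof.
move=> Hphi Hpsi; split=> [x y|a x|x y] /=.
- by rewrite (kmorphD Hpsi) (kmorphD Hphi).
- by rewrite (kmorphZ Hpsi) (kmorphZ Hphi).
- by rewrite (kmorphM Hpsi) (kmorphM Hphi).
Qed.

Lemma kalg_morph_iter (k : comPzRingType) (R : lmodType k) (mul : R -> R -> R)
    (f : R -> R) n :
  is_kalg_morph mul mul f -> is_kalg_morph mul mul (iter n f).
Proof.
move=> Hf; elim: n => [|n IH]; first by split.
exact: kalg_morph_comp Hf IH.
Qed.

Section GAlgebra.
Variables (k : comPzRingType) (G : groupType) (R : lmodType k).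
Variables (mul : R -> R -> R) (C : G -> G -> pred R) (one : G -> R).
Hypothesis HR : is_Galgebra mul C one.

Lemma Galg_kalg : is_kalg_nonunital mul.
Proof. by case: HR. Qed.
Lemma Galg_submod f g : is_submod (C f g).
Proof. by case: HR => _ []. Qed.
Lemma Galg_span x : exists (s : seq (G * G)) (y : G * G -> R),
  (forall p, p \in s -> y p \in C p.1 p.2) /\ x = \sum_(p <- s) y p.
Proof. by case: HR => _ [_ [[+ _] _]]; apply. Qed.
Lemma Galg_mulC f g h x y : x \in C f g -> y \in C g h -> mul x y \in C f h.
Proof. by case: HR => _ [_ [_ [+ _]]]; apply. Qed.
Lemma Galg_mul_eq0 f g g' h x y :
  g != g' -> x \in C f g -> y \in C g' h -> mul x y = 0.
Proof. by case: HR => _ [_ [_ [_ [+ _]]]]; apply. Qed.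
Lemma Galg_one_C f : one f \in C f f.
Proof. by case: HR => _ [_ [_ [_ [_ /(_ f) []]]]]. Qed.
Lemma Galg_mul_one f g x : x \in C g f -> mul x (one f) = x.
Proof. by case: HR => _ [_ [_ [_ [_ /(_ f) [_ [+ _]]]]]]; apply. Qed.
Lemma Galg_one_mul f g x : x \in C f g -> mul (one f) x = x.
Proof. by case: HR => _ [_ [_ [_ [_ /(_ f) [_ [_ +]]]]]]; apply. Qed.

Lemma Galg_one_one f g : mul (one f) (one g) = if f == g then one g else 0.
Proof.
have [->|ne] := eqVneq f g; first exact: Galg_one_mul (Galg_one_C g).
exact: Galg_mul_eq0 ne (Galg_one_C f) (Galg_one_C g).
Qed.

Definition comp x f g := mul (mul (one f) x) (one g).

Lemma comp_homog a b f g x : x \in C a b ->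
  comp x f g = if (a, b) == (f, g) then x else 0.
Proof.
move=> xC; rewrite /comp xpair_eqE.
have [<-|ne] /= := eqVneq a f; last first.
  rewrite eq_sym in ne.
  by rewrite (Galg_mul_eq0 ne (Galg_one_C f) xC) (kalg_mul0l Galg_kalg).
rewrite (Galg_one_mul xC); have [<-|ne] := eqVneq b g; first exact: Galg_mul_one xC.
exact: Galg_mul_eq0 ne xC (Galg_one_C g).
Qed.

Lemma compD x y f g : comp (x + y) f g = comp x f g + comp y f g.
Proof. by rewrite /comp (kalg_mulDr Galg_kalg) (kalg_mulDl Galg_kalg). Qed.

Lemma compZ a x f g : comp (a *: x) f g = a *: comp x f g.
Proof. by rewrite /comp (kalg_mulZr Galg_kalg) (kalg_mulZl Galg_kalg). Qed.

Lemma comp_sum (J : Type) (s : seq J) (F : J -> R) f g :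
  comp (\sum_(j <- s) F j) f g = \sum_(j <- s) comp (F j) f g.
Proof. by rewrite /comp (kalg_mul_sumr Galg_kalg) (kalg_mul_suml Galg_kalg). Qed.

Lemma comp_C x f g : comp x f g \in C f g.
Proof.
have [s [y [yC ->]]] := Galg_span x.
rewrite comp_sum big_seq big_mkcond; apply: (submod_sum (Galg_submod f g)) => p.
case: ifP => [/yC ypC|_]; last exact: submod0 (Galg_submod f g).
by rewrite (comp_homog _ _ ypC); case: eqP => [[<- <-]|_] //; apply: submod0 (Galg_submod _ _).
Qed.

Lemma comp_decomposition x : exists s : seq (G * G),
  [/\ uniq s, (forall p, p \notin s -> comp x p.1 p.2 = 0)
    & x = \sum_(p <- s) comp x p.1 p.2].
Proof.
have [s [y [yC ->]]] := Galg_span x.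
have compE p : comp (\sum_(q <- s) y q) p.1 p.2 =
    \sum_(q <- s) (if q == p then y q else 0).
  rewrite comp_sum big_seq [RHS]big_seq; apply: eq_bigr => q /yC qC.
  by rewrite (comp_homog _ _ qC) -!surjective_pairing.
exists (undup s); split=> [|p|]; first exact: undup_uniq.
  rewrite mem_undup compE => ps; rewrite big_seq big1 // => q qs.
  by case: eqP => // qp; rewrite -qp qs in ps.
under [RHS]eq_bigr do rewrite compE.
rewrite exchange_big /= big_seq [RHS]big_seq; apply: eq_bigr => q qs.
under eq_bigr do rewrite eq_sym.
by rewrite (sum_seq_delta (fun=> y q)) ?undup_uniq // mem_undup qs.
Qed.

Lemma comp_inj x y : (forall f g, comp x f g = comp y f g) -> x = y.
Proof.
move=> xy; have [s [us xs ->]] := comp_decomposition x.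
have [t [ut yt ->]] := comp_decomposition y.
under eq_bigr do rewrite xy.
by apply: sum_supported_eq => // p /xs; rewrite xy.
Qed.

Lemma comp_comp x f g a b :
  comp (comp x f g) a b = if (f, g) == (a, b) then comp x f g else 0.
Proof. exact: comp_homog (comp_C x f g). Qed.

Lemma C_of_comp x a b :
  (forall f g, (f, g) != (a, b) -> comp x f g = 0) -> x \in C a b.
Proof.
move=> x0; suff -> : x = comp x a b by apply: comp_C.
apply: comp_inj => f g; rewrite comp_comp eq_sym.
by case: eqP => [[-> ->]|/eqP]; last apply: x0.
Qed.

Lemma one_mul_decomposition x f (s : seq G) : uniq s ->
  (forall g, g \notin s -> comp x f g = 0) ->
  mul (one f) x = \sum_(g <- s) comp x f g.
Proof.
move=> us xs; apply: comp_inj => a b; rewrite comp_sum.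
under eq_bigr do rewrite comp_comp xpair_eqE.
rewrite {1}/comp (kalg_mulA Galg_kalg) Galg_one_one.
have [_|ne] /= := eqVneq f a; last by rewrite big1 // !(kalg_mul0l Galg_kalg).
rewrite (sum_seq_delta (comp x f)) //.
by case: ifP => // /negbT /xs.
Qed.

Lemma comp_mul x y f h (s : seq G) : uniq s ->
  (forall g, g \notin s -> comp x f g = 0) ->
  comp (mul x y) f h = \sum_(g <- s) mul (comp x f g) (comp y g h).
Proof.
move=> us xs; have mulA := kalg_mulA Galg_kalg.
rewrite {1}/comp mulA (one_mul_decomposition us xs) !(kalg_mul_suml Galg_kalg).
apply: eq_bigr => g _; rewrite [comp y g h]/comp mulA (mulA _ (one g)).
by rewrite (Galg_mul_one (comp_C x f g)).
Qed.

Lemma C_disjoint a b a' b' x : x \in C a b -> x \in C a' b' -> x != 0 ->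
  (a, b) = (a', b').
Proof.
move=> xC xC' nx; apply/eqP; apply: contraNT nx => ne.
have := comp_homog a' b' xC; rewrite (negbTE ne) => <-.
by rewrite (comp_homog _ _ xC') eqxx.
Qed.

Lemma exists_homog_nonzero : (exists x : R, x != 0) ->
  exists a b (y : R), y \in C a b /\ y != 0.
Proof.
case=> x; have [s [_ _ ->]] := comp_decomposition x.
have [/hasP [p _ np] _|/hasPn s0] := boolP (has (fun p => comp x p.1 p.2 != 0) s).
  by exists p.1, p.2, (comp x p.1 p.2); rewrite comp_C.
by rewrite big_seq big1 ?eqxx // => p ps; apply/eqP; move: (s0 p ps); rewrite negbK.
Qed.

Section GradedMap.
Variables (psi : R -> R) (h : G).
Hypothesis Hpsi : is_kalg_morph mul mul psi.
Hypothesis psi_h : graded_of_degree C C psi h.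

Lemma comp_graded y f g : psi (comp y f g) = comp (psi y) (h * f) (h * g).
Proof.
have [s [us ys ey]] := comp_decomposition y.
rewrite [in RHS]ey (kmorph_sum Hpsi) comp_sum.
under [RHS]eq_bigr => p _.
  rewrite (comp_homog _ _ (psi_h (comp_C y p.1 p.2))) !xpair_eqE.
  rewrite !(inj_eq (mulgI h)) -xpair_eqE -surjective_pairing.
over.
rewrite (sum_seq_delta (fun p => psi (comp y p.1 p.2))) //.
by case: ifP => // /negbT /ys /= ->; apply: kmorph0 Hpsi.
Qed.

Lemma graded_degree_unique h' : (exists x : R, x != 0) -> injective psi ->
  graded_of_degree C C psi h' -> h = h'.
Proof.
move=> /exists_homog_nonzero [a [b [y [yC ny]]]] psi_inj psi_h'.
have npsi : psi y != 0 by rewrite -(kmorph0 Hpsi) (inj_eq psi_inj).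
by case: (C_disjoint (psi_h yC) (psi_h' _ _ _ yC) npsi) => /mulIg.
Qed.

Variable psi' : R -> R.
Hypotheses (psiK : cancel psi psi') (psi'K : cancel psi' psi).

Lemma graded_can : graded_of_degree C C psi' h^-1.
Proof.
move=> a b x xC; apply: C_of_comp => f g ne.
have := comp_graded (psi' x) f g; rewrite psi'K (comp_homog _ _ xC).
case: eqP => [[ea eb]|_ psi0]; first by rewrite ea eb !mulKg eqxx in ne.
by rewrite -[LHS]psiK psi0 (kmorph0 (kalg_morph_can Hpsi psiK psi'K)).
Qed.

Lemma graded_one f : psi (one f) = one (h * f).
Proof.
have psi'1 : psi' (one (h * f)) \in C f f.
  by have := graded_can (Galg_one_C (h * f)); rewrite mulKg.
rewrite -(Galg_mul_one (psi_h (Galg_one_C f))) -{1}(psi'K (one (h * f))).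
by rewrite -(kmorphM Hpsi) (Galg_one_mul psi'1) psi'K.
Qed.

End GradedMap.

End GAlgebra.

Section PrincipalShift.
Variables (k : comPzRingType) (G : groupType) (R : lmodType k).
Variables (mul : R -> R -> R) (C : G -> G -> pred R) (one : G -> R).
Hypothesis HR : is_Galgebra mul C one.
Variables (A : lmodType k) (mulA : A -> A -> A) (oneA : A) (Ag : G -> pred A).
Variable phi : R -> G -> G -> A.
Hypothesis HA : is_Ggraded_kalg mulA oneA Ag.
Hypothesis Hphi : Galg_iso_bar mul one mulA oneA Ag phi.

Let HmulA : is_kalg_nonunital mulA. Proof. by case: HA => -[]. Qed.
Let mulA_1x x : mulA oneA x = x. Proof. by case: HA => -[]. Qed.
Let mulA_x1 x : mulA x oneA = x. Proof. by case: HA => -[]. Qed.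

Let phiD x y f g : phi (x + y) f g = phi x f g + phi y f g.
Proof. by case: Hphi. Qed.
Let phiZ a x f g : phi (a *: x) f g = a *: phi x f g.
Proof. by case: Hphi => _ []. Qed.
Let phi_inj x y : (forall f g, phi x f g = phi y f g) -> x = y.
Proof. by case: Hphi => _ [_ [+ _]]; apply. Qed.
Let phi_bar x : in_bar Ag (phi x).
Proof. by case: Hphi => _ [_ [_ [+ _]]]. Qed.
Let phi_surj z : in_bar Ag z -> exists x, forall f g, phi x f g = z f g.
Proof. by case: Hphi => _ [_ [_ [_ [+ _]]]]; apply. Qed.
Let phiM x y f h (s : seq G) : uniq s -> (forall g, g \notin s -> phi x f g = 0) ->
  phi (mul x y) f h = \sum_(g <- s) mulA (phi x f g) (phi y g h).
Proof. by case: Hphi => _ [_ [_ [_ [_ [+ _]]]]]; apply. Qed.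
Let phi_one f a b : phi (one f) a b = if (a == f) && (b == f) then oneA else 0.
Proof. by case: Hphi => _ [_ [_ [_ [_ [_ +]]]]]; apply. Qed.

Lemma phi_row_support x a :
  exists s : seq G, uniq s /\ forall c, c \notin s -> phi x a c = 0.
Proof.
have [[s xs] _] := phi_bar x.
exists (undup (map snd s)); split=> [|c]; first exact: undup_uniq.
rewrite mem_undup => ncs; apply: xs; apply: contra ncs => acs.
by apply/mapP; exists (a, c).
Qed.

Lemma phi_one_mul y f a b :
  phi (mul (one f) y) a b = if a == f then phi y a b else 0.
Proof.
rewrite (@phiM _ _ _ _ [:: f]) //; last first.
  by move=> g; rewrite inE phi_one => /negbTE ->; rewrite andbF.
rewrite big_seq1 phi_one eqxx andbT.
by case: eqP => [->|_]; rewrite ?mulA_1x ?(kalg_mul0l HmulA).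
Qed.

Lemma phi_mul_one y h a b :
  phi (mul y (one h)) a b = if b == h then phi y a b else 0.
Proof.
have [s [us ys]] := phi_row_support y a.
rewrite (phiM (one h) b us ys); under eq_bigr do rewrite phi_one.
have [->|nbh] := eqVneq b h; last by rewrite big1 // => g _; rewrite andbF (kalg_mul0r HmulA).
under eq_bigr do rewrite andbT (fun_if (mulA _)) mulA_x1 (kalg_mul0r HmulA).
by rewrite (sum_seq_delta (phi y a)) //; case: ifP => // /negbT /ys.
Qed.

Lemma phi_comp x f g a b :
  phi (comp mul one x f g) a b = if (a, b) == (f, g) then phi x a b else 0.
Proof.
rewrite phi_mul_one phi_one_mul xpair_eqE.
by case: (a == f); case: (b == g).
Qed.

Lemma phi_C x f g a b : x \in C f g -> (a, b) != (f, g) -> phi x a b = 0.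
Proof.
move=> xC ne; have := comp_homog HR f g xC; rewrite eqxx => <-.
by rewrite phi_comp (negbTE ne).
Qed.

Lemma C_of_phi y f g :
  (forall a b, (a, b) != (f, g) -> phi y a b = 0) -> y \in C f g.
Proof.
move=> y0; suff -> : y = comp mul one y f g by apply: comp_C.
apply: phi_inj => a b; rewrite phi_comp.
by case: eqP => // /eqP /y0.
Qed.

Lemma shift_exists g x :
  exists y, forall a b, phi y a b = phi x (g^-1 * a) (g^-1 * b).
Proof.
apply: phi_surj; have [[s xs] xAg] := phi_bar x; split.
  exists (map (fun p => (g * p.1, g * p.2)%g) s) => a b nab; apply: xs.
  apply: contra nab => abs; apply/mapP; exists (g^-1 * a, g^-1 * b)%g => //=.
  by rewrite !mulVKg.
by move=> a b; have := xAg (g^-1 * a)%g (g^-1 * b)%g; rewrite invgM invgK -mulgA mulVKg.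
Qed.

Definition shift g x := proj1_sig (constructive_indefinite_description _ (shift_exists g x)).

Lemma shiftE g x a b : phi (shift g x) a b = phi x (g^-1 * a) (g^-1 * b).
Proof. exact: (proj2_sig (constructive_indefinite_description _ (shift_exists g x))). Qed.

Lemma shiftM g h x : shift (g * h) x = shift g (shift h x).
Proof. by apply: phi_inj => a b; rewrite !shiftE invgM -!mulgA. Qed.

Lemma shift1 x : shift 1 x = x.
Proof. by apply: phi_inj => a b; rewrite shiftE invg1 !mul1g. Qed.

Lemma shift_morph g : is_kalg_morph mul mul (shift g).
Proof.
split=> [x y|c x|x y]; apply: phi_inj => a b; rewrite !shiftE ?phiD ?phiZ ?shiftE //.
have [s [us xs]] := phi_row_support x (g^-1 * a)%g.
rewrite (phiM y (g^-1 * b)%g us xs).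
have gus : uniq [seq (g * c)%g | c <- s] by rewrite map_inj_uniq //; apply: mulgI.
rewrite (@phiM _ _ _ _ [seq (g * c)%g | c <- s]) // => [|c ncs]; last first.
  rewrite shiftE xs //; apply: contra ncs => gcs.
  by apply/mapP; exists (g^-1 * c)%g; rewrite ?mulVKg.
by rewrite big_map; apply: eq_bigr => c _; rewrite !shiftE mulKg.
Qed.

Lemma shift_aut g : is_kalg_aut mul (shift g).
Proof.
split; first exact: shift_morph.
by exists (shift g^-1) => x; rewrite -shiftM ?mulVg ?mulgV shift1.
Qed.

Lemma shift_graded g : graded_of_degree C C (shift g) g.
Proof.
move=> f h x xC; apply: C_of_phi => a b ne; rewrite shiftE (phi_C xC) //.
by apply: contra ne => /eqP [<- <-]; rewrite !mulVKg.
Qed.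

End PrincipalShift.

Lemma principal_graded_action (k : comPzRingType) (G : groupType) (R : lmodType k)
    (mul : R -> R -> R) (C : G -> G -> pred R) (one : G -> R) :
  is_Galgebra mul C one -> principal mul one ->
  exists T : G -> R -> R, [/\ forall g, is_kalg_aut mul (T g),
    forall g h x, T (g * h)%g x = T g (T h x) &
    forall g, graded_of_degree C C (T g) g].
Proof.
move=> HR [A [mulA [oneA [Ag [HA [phi Hphi]]]]]].
exists (shift Hphi); split.
- exact: shift_aut.
- exact: shiftM.
- exact: shift_graded.
Qed.

Section LeftFixed.
Variables (k : comPzRingType) (R : lmodType k) (mul : R -> R -> R) (e : R).
Hypothesis Hmul : is_kalg_nonunital mul.

(* The unused proof argument lets the submodule instance below rely on the
   bilinearity of [mul]. *)
Definition left_fixed of is_kalg_nonunital mul : {pred R} := [pred x | mul e x == x].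

Lemma left_fixed_submod_closed : GRing.submod_closed (left_fixed Hmul).
Proof.
split=> [|a x y]; rewrite !inE; first by rewrite (kalg_mul0r Hmul).
by move=> /eqP ex /eqP ey; rewrite (kalg_mulDr Hmul) (kalg_mulZr Hmul) ex ey.
Qed.

HB.instance Definition _ :=
  GRing.isSubmodClosed.Build k R (left_fixed Hmul) left_fixed_submod_closed.

Record left_fixed_type : predArgType :=
  LeftFixed { left_fixed_val : R; _ : left_fixed_val \in left_fixed Hmul }.

HB.instance Definition _ := [isSub for left_fixed_val].
HB.instance Definition _ := [Choice of left_fixed_type by <:].
HB.instance Definition _ := [SubChoice_isSubLmodule of left_fixed_type by <:].

Lemma left_fixedP (a : left_fixed_type) : mul e (val a) = val a.
Proof. by apply/eqP; case: a. Qed.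

Lemma left_fixed_valD (a b : left_fixed_type) : val (a + b) = val a + val b.
Proof. by []. Qed.

Lemma left_fixed_valZ c (a : left_fixed_type) : val (c *: a) = c *: val a.
Proof. by []. Qed.

Lemma left_fixed_val_sum (J : Type) (s : seq J) (F : J -> left_fixed_type) :
  val (\sum_(j <- s) F j) = \sum_(j <- s) val (F j).
Proof. exact: raddf_sum. Qed.

End LeftFixed.

Section ActionToPrincipal.
Variables (k : comPzRingType) (G : groupType) (R : lmodType k).
Variables (mul : R -> R -> R) (C : G -> G -> pred R) (one : G -> R).
Hypothesis HR : is_Galgebra mul C one.
Variable T : G -> R -> R.
Hypothesis T_aut : forall g, is_kalg_aut mul (T g).
Hypothesis TM : forall g h x, T (g * h)%g x = T g (T h x).
Hypothesis T_graded : forall g, graded_of_degree C C (T g) g.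

Let Hmul : is_kalg_nonunital mul := Galg_kalg HR.
Let mulRA := kalg_mulA Hmul.
Let T_morph g : is_kalg_morph mul mul (T g). Proof. by case: (T_aut g). Qed.

Lemma action1 x : T 1 x = x.
Proof. by case: (T_aut 1) => _ /bij_inj; apply; rewrite -TM mulg1. Qed.

Lemma actionK g : cancel (T g) (T g^-1).
Proof. by move=> x; rewrite -TM mulVg action1. Qed.

Lemma actionVK g : cancel (T g^-1) (T g).
Proof. by move=> x; rewrite -TM mulgV action1. Qed.

Lemma action_one g f : T g (one f) = one (g * f).
Proof. exact: (graded_one HR (T_morph g) (T_graded g) (actionK g) (actionVK g)). Qed.

Local Notation e := (one 1).
Local Notation A := (left_fixed_type e Hmul).

Lemma left_fixed_C y h : y \in C 1 h -> y \in left_fixed e Hmul.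
Proof. by move=> yC; rewrite inE (Galg_one_mul HR yC). Qed.

Definition entry (a : A) g := mul (val a) (one g).

Lemma entryE a g : entry a g = comp mul one (val a) 1 g.
Proof. by rewrite /comp left_fixedP. Qed.

Lemma entry_C a g : entry a g \in C 1 g.
Proof. by rewrite entryE comp_C. Qed.

Lemma entryD a b g : entry (a + b) g = entry a g + entry b g.
Proof. exact: kalg_mulDl. Qed.

Lemma entryZ c a g : entry (c *: a) g = c *: entry a g.
Proof. exact: kalg_mulZl. Qed.

Definition supports (s : seq G) (a : A) := forall g, g \notin s -> entry a g = 0.

Lemma supports_exists a : exists s, uniq s /\ supports s a.
Proof.
have [s [_ as0 _]] := comp_decomposition HR (val a).
exists (undup (map snd s)); split=> [|g]; first exact: undup_uniq.
rewrite mem_undup entryE => gs; apply: (as0 (1%g, g)).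
by apply: contra gs => gs; apply/mapP; exists (1%g, g).
Qed.

Definition entry_support a :=
  proj1_sig (constructive_indefinite_description _ (supports_exists a)).

Lemma entry_support_uniq a : uniq (entry_support a).
Proof. by case: (proj2_sig (constructive_indefinite_description _ (supports_exists a))). Qed.

Lemma supports_entry_support a : supports (entry_support a) a.
Proof. by case: (proj2_sig (constructive_indefinite_description _ (supports_exists a))). Qed.
Arguments supports_entry_support : clear implicits.

Lemma supports_sub s t a : supports s a -> {subset s <= t} -> supports t a.
Proof. by move=> sa st g gt; apply: sa; apply: contra gt; apply: st. Qed.

Lemma supportsD s a b : supports s a -> supports s b -> supports s (a + b).
Proof. by move=> sa sb g gs; rewrite entryD sa ?sb ?addr0. Qed.

Lemma supportsZ s c a : supports s a -> supports s (c *: a).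
Proof. by move=> sa g gs; rewrite entryZ sa ?scaler0. Qed.

Lemma left_fixed_entry_sum a s : uniq s -> supports s a ->
  val a = \sum_(g <- s) entry a g.
Proof.
move=> us sa; rewrite -{1}(left_fixedP a) (one_mul_decomposition HR us).
  by apply: eq_bigr => g _; rewrite entryE.
by move=> g /sa; rewrite entryE.
Qed.

Definition row_mul_val (a b : A) :=
  \sum_(g <- entry_support a) mul (entry a g) (T g (val b)).

Lemma row_mul_val_fixed a b : row_mul_val a b \in left_fixed e Hmul.
Proof.
rewrite inE /row_mul_val (kalg_mul_sumr Hmul); apply/eqP/eq_bigr => g _.
by rewrite mulRA (Galg_one_mul HR (entry_C a g)).
Qed.

Definition row_mul a b : A := LeftFixed (row_mul_val_fixed a b).

Lemma row_mulE a b s : uniq s -> supports s a ->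
  val (row_mul a b) = \sum_(g <- s) mul (entry a g) (T g (val b)).
Proof.
move=> us sa; apply: sum_supported_eq => //; first exact: entry_support_uniq.
  by move=> g /supports_entry_support ->; rewrite (kalg_mul0l Hmul).
by move=> g /sa ->; rewrite (kalg_mul0l Hmul).
Qed.

Lemma entry_sum (J : Type) (s : seq J) (F : J -> A) g :
  entry (\sum_(j <- s) F j) g = \sum_(j <- s) entry (F j) g.
Proof. by rewrite /entry left_fixed_val_sum (kalg_mul_suml Hmul). Qed.

Lemma row_mulDl a b c : row_mul (a + b) c = row_mul a c + row_mul b c.
Proof.
apply: val_inj; set s := undup (entry_support a ++ entry_support b).
have us : uniq s := undup_uniq _.
have sa : supports s a.
  by apply: (supports_sub (supports_entry_support a)) => g; rewrite mem_undup mem_cat => ->.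
have sb : supports s b.
  apply: (supports_sub (supports_entry_support b)) => g.
  by rewrite mem_undup mem_cat => ->; rewrite orbT.
rewrite left_fixed_valD (row_mulE c us (supportsD sa sb)).
rewrite (row_mulE c us sa) (row_mulE c us sb).
by rewrite -big_split; apply: eq_bigr => g _; rewrite entryD (kalg_mulDl Hmul).
Qed.

Lemma row_mulDr a b c : row_mul a (b + c) = row_mul a b + row_mul a c.
Proof.
apply: val_inj; have sa := supports_entry_support a.
rewrite left_fixed_valD !(row_mulE _ (entry_support_uniq a) sa) -big_split.
by apply: eq_bigr => g _; rewrite left_fixed_valD (kmorphD (T_morph g)) (kalg_mulDr Hmul).
Qed.

Lemma row_mulZl c a b : row_mul (c *: a) b = c *: row_mul a b.
Proof.
apply: val_inj; have sa := supports_entry_support a.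
rewrite left_fixed_valZ (row_mulE b (entry_support_uniq a) (supportsZ c sa)).
rewrite (row_mulE b (entry_support_uniq a) sa) scaler_sumr.
by apply: eq_bigr => g _; rewrite entryZ (kalg_mulZl Hmul).
Qed.

Lemma row_mulZr c a b : row_mul a (c *: b) = c *: row_mul a b.
Proof.
apply: val_inj; have sa := supports_entry_support a.
rewrite left_fixed_valZ !(row_mulE _ (entry_support_uniq a) sa) scaler_sumr.
by apply: eq_bigr => g _; rewrite left_fixed_valZ (kmorphZ (T_morph g)) (kalg_mulZr Hmul).
Qed.

Lemma entry_row_mul a b m : entry (row_mul a b) m =
  \sum_(h <- entry_support a) mul (entry a h) (T h (entry b (h^-1 * m))).
Proof.
rewrite {1}/entry (row_mulE b (entry_support_uniq a) (supports_entry_support a)).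
rewrite (kalg_mul_suml Hmul); apply: eq_bigr => h _; rewrite -mulRA.
by rewrite /entry (kmorphM (T_morph h)) action_one mulVKg.
Qed.

Lemma row_mulA a b c : row_mul a (row_mul b c) = row_mul (row_mul a b) c.
Proof.
(* Both sides are sums of a_{1,h} T_h(b_{1,g}) T_{hg}(c); on the right the
   index m = h g is recovered from h by reindexing. *)
apply: val_inj.
set s := undup (entry_support (row_mul a b) ++
  [seq (h * g)%g | h <- entry_support a, g <- entry_support b]).
have us : uniq s := undup_uniq _.
have sab : supports s (row_mul a b).
  by apply: (supports_sub (supports_entry_support _)) => g; rewrite mem_undup mem_cat => ->.
rewrite (row_mulE c us sab) (row_mulE _ (entry_support_uniq a) (supports_entry_support a)).
under [RHS]eq_bigr do rewrite entry_row_mul (kalg_mul_suml Hmul).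
rewrite [RHS]exchange_big [LHS]big_seq [RHS]big_seq; apply: eq_bigr => h ha.
rewrite (row_mulE c (entry_support_uniq b) (supports_entry_support b)).
rewrite (kmorph_sum (T_morph h)) (kalg_mul_sumr Hmul).
have vanish m : (h^-1 * m)%g \notin entry_support b ->
    mul (mul (entry a h) (T h (entry b (h^-1 * m)))) (T m (val c)) = 0.
  move=> /supports_entry_support ->.
  by rewrite (kmorph0 (T_morph h)) (kalg_mul0r Hmul) (kalg_mul0l Hmul).
rewrite [RHS](@sum_supported_eq _ _ s [seq (h * g)%g | g <- entry_support b]) //.
- rewrite big_map; apply: eq_bigr => g _.
  by rewrite mulKg (kmorphM (T_morph h)) TM mulRA.
- by rewrite map_inj_uniq ?entry_support_uniq //; apply: mulgI.
- move=> m ms; apply: vanish; apply: contra ms => bm.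
  rewrite mem_undup mem_cat -[m](mulVKg h); apply/orP; right.
  exact: allpairs_f.
- move=> m ms; apply: vanish; apply: contra ms => bm.
  by apply/mapP; exists (h^-1 * m)%g; rewrite ?mulVKg.
Qed.

Definition row_one : A := LeftFixed (left_fixed_C (Galg_one_C HR 1)).

Lemma row_mul_homog a b m : val a \in C 1 m -> val (row_mul a b) = mul (val a) (T m (val b)).
Proof.
move=> aC; have sa : supports [:: m] a.
  by move=> g; rewrite inE eq_sym => mg; exact: (Galg_mul_eq0 HR mg aC (Galg_one_C HR g)).
by rewrite (row_mulE b _ sa) // big_seq1 /entry (Galg_mul_one HR aC).
Qed.

Lemma row_one_C : val row_one \in C 1 1.
Proof. exact: (Galg_one_C HR 1). Qed.

Lemma row_mul1l b : row_mul row_one b = b.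
Proof. by apply: val_inj; rewrite (row_mul_homog b row_one_C) action1 left_fixedP. Qed.

Lemma row_mul1r a : row_mul a row_one = a.
Proof.
apply: val_inj; have sa := supports_entry_support a.
rewrite (row_mulE row_one (entry_support_uniq a) sa).
rewrite [RHS](left_fixed_entry_sum (entry_support_uniq a) sa).
by apply: eq_bigr => g _; rewrite action_one mulg1 (Galg_mul_one HR (entry_C a g)).
Qed.

Definition row_grading (h : G) : pred A := [pred a : A | val a \in C 1 h].

Lemma entry_homog a g i : val a \in C 1 g -> entry a i = if g == i then val a else 0.
Proof. by move=> aC; rewrite entryE (comp_homog HR _ _ aC) xpair_eqE eqxx. Qed.

Lemma row_grading_direct_sum : is_direct_sum row_grading.
Proof.
split=> [a|s y us yC sum0 i si].
  exists (entry_support a), (fun g => LeftFixed (left_fixed_C (entry_C a g))).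
  split=> [g _|]; first by rewrite inE entry_C.
  apply: val_inj; rewrite left_fixed_val_sum.
  exact: left_fixed_entry_sum (entry_support_uniq a) (supports_entry_support a).
apply: val_inj; have := congr1 (entry^~ i) sum0.
rewrite entry_sum /entry [mul (val 0) _](kalg_mul0l Hmul).
under eq_bigr => j _ do rewrite -/(entry (y j) i).
rewrite big_seq; under eq_bigr => j sj do rewrite (entry_homog i (yC j sj)).
by rewrite -big_seq (sum_seq_delta (fun j => val (y j))) // si.
Qed.

Lemma row_algebra_graded : is_Ggraded_kalg row_mul row_one row_grading.
Proof.
split.
- split; [split | exact: row_mul1l | exact: row_mul1r].
  + exact: row_mulDl.
  + exact: row_mulDr.
  + exact: row_mulZl.
  + exact: row_mulZr.
  + exact: row_mulA.
- move=> h; have CP := Galg_submod HR 1 h; split; rewrite ?inE.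
  + exact: submod0 CP.
  + by move=> a b; rewrite !inE left_fixed_valD; exact: (submodD CP).
  + by move=> c a; rewrite !inE left_fixed_valZ; exact: (submodZ CP c).
- exact: row_grading_direct_sum.
- move=> g h y z; rewrite !inE => yC zC; rewrite (row_mul_homog z yC).
  have TzC := T_graded g zC; rewrite mulg1 in TzC.
  exact: (Galg_mulC HR yC TzC).
Qed.

Lemma T_comp_C x f g : T f^-1 (comp mul one x f g) \in C 1 (f^-1 * g).
Proof. by have := T_graded f^-1 (comp_C HR x f g); rewrite mulVg. Qed.

Definition to_bar x f g : A := LeftFixed (left_fixed_C (T_comp_C x f g)).

Lemma to_bar_C x f g : val (to_bar x f g) \in C 1 (f^-1 * g).
Proof. exact: T_comp_C. Qed.

Lemma to_bar_inj x y : (forall f g, to_bar x f g = to_bar y f g) -> x = y.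
Proof.
move=> xy; apply: (comp_inj HR) => f g.
by move: (congr1 val (xy f g)) => /= /(can_inj (actionK f^-1)).
Qed.

Lemma to_bar_in_bar x : in_bar row_grading (to_bar x).
Proof.
split=> [|f g]; last exact: to_bar_C.
have [s [_ xs _]] := comp_decomposition HR x.
by exists s => f g /(xs (f, g)) xfg; apply: val_inj; rewrite /= xfg (kmorph0 (T_morph _)).
Qed.

Lemma to_bar_surj z : in_bar row_grading z ->
  exists x, forall f g, to_bar x f g = z f g.
Proof.
case=> [[s zs] zC]; have TzC f g : T f (val (z f g)) \in C f g.
  by have := T_graded f (zC f g); rewrite mulg1 mulVKg.
exists (\sum_(p <- undup s) T p.1 (val (z p.1 p.2))) => a b; apply: val_inj.
rewrite /= (comp_sum HR).
under eq_bigr => p _ do rewrite (comp_homog HR _ _ (TzC p.1 p.2)) -surjective_pairing.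
rewrite (sum_seq_delta (fun p => T p.1 (val (z p.1 p.2)))) ?undup_uniq // mem_undup.
by case: ifP => [_|/negbT /zs ->]; [apply: actionK | rewrite (kmorph0 (T_morph _))].
Qed.

Lemma to_bar_mul x y f h (s : seq G) : uniq s ->
  (forall g, g \notin s -> to_bar x f g = 0) ->
  to_bar (mul x y) f h = \sum_(g <- s) row_mul (to_bar x f g) (to_bar y g h).
Proof.
move=> us xs; have xs' g : g \notin s -> comp mul one x f g = 0.
  move=> /xs /(congr1 val) /= x0.
  by rewrite -[LHS](actionK f^-1) x0 !(kmorph0 (T_morph _)).
apply: val_inj; rewrite /= (comp_mul HR y h us xs') (kmorph_sum (T_morph _)).
rewrite left_fixed_val_sum; apply: eq_bigr => g _.
rewrite (row_mul_homog _ (to_bar_C x f g)) /= (kmorphM (T_morph _)).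
by rewrite -TM mulgK.
Qed.

Lemma to_bar_one f a b :
  to_bar (one f) a b = if (a == f) && (b == f) then row_one else 0.
Proof.
apply: val_inj; rewrite /= (comp_homog HR _ _ (Galg_one_C HR f)) xpair_eqE !(eq_sym f).
case: ifP => [/andP [/eqP -> _]|_]; first by rewrite action_one mulVg.
exact: kmorph0 (T_morph _).
Qed.

Lemma to_bar_iso : Galg_iso_bar mul one row_mul row_one row_grading to_bar.
Proof.
split=> [x y f g|].
  by apply: val_inj; rewrite left_fixed_valD /= (compD HR) (kmorphD (T_morph _)).
split=> [c x f g|].
  by apply: val_inj; rewrite left_fixed_valZ /= (compZ HR) (kmorphZ (T_morph _)).
split; first exact: to_bar_inj.
split; first exact: to_bar_in_bar.
split; first exact: to_bar_surj.
split; [exact: to_bar_mul | exact: to_bar_one].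
Qed.

Lemma graded_action_principal : principal mul one.
Proof.
exists A, row_mul, row_one, row_grading; split; first exact: row_algebra_graded.
by exists to_bar; apply: to_bar_iso.
Qed.

End ActionToPrincipal.

Lemma Zgrp_mulE (a b : Zgrp) : (a * b)%g = a + b :> int.
Proof. by []. Qed.

Section IntAction.
Variables (k : comPzRingType) (R : lmodType k).
Variables (mul : R -> R -> R) (C : Zgrp -> Zgrp -> pred R) (one : Zgrp -> R).
Hypothesis HR : is_Galgebra mul C one.
Variables psi psi' : R -> R.
Hypothesis Hpsi : is_kalg_morph mul mul psi.
Hypothesis psi_1 : graded_of_degree C C psi Zgrp_one.
Hypotheses (psiK : cancel psi psi') (psi'K : cancel psi' psi).

(* [Negz m] is the integer -(m + 1). *)
Definition zpow (n : Zgrp) : R -> R :=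
  match n with Posz m => iter m psi | Negz m => iter m.+1 psi' end.

Lemma zpowS (n : int) x : zpow (n + 1) x = psi (zpow n x).
Proof.
case: n => [m|[|m]] /=; first by rewrite addn1.
  by rewrite psi'K.
by rewrite subn1 /= psi'K.
Qed.

Lemma zpowN1 (n : int) x : zpow (n - 1) x = psi' (zpow n x).
Proof. by rewrite -[in RHS](subrK 1 n) zpowS psiK. Qed.

Lemma zpowD (n m : int) x : zpow (n + m) x = zpow n (zpow m x).
Proof.
elim/int_ind: n m x => [|n IH|n IH] m x; first by rewrite add0r.
  by rewrite -addn1 PoszD -addrA (addrC 1) addrA !zpowS IH.
by rewrite -addn1 PoszD opprD -addrA (addrC (-1)) addrA !zpowN1 IH.
Qed.

Lemma zpow_graded (n : Zgrp) : graded_of_degree C C (zpow n) n.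
Proof.
have psi'_1 := graded_can HR Hpsi psi_1 psiK psi'K.
move=> f g x xC; rewrite !Zgrp_mulE.
elim/int_ind: n => [|n IH|n IH]; first by rewrite !add0r.
  have := psi_1 IH; rewrite !Zgrp_mulE -addn1 PoszD zpowS.
  by rewrite -!addrA !(addrCA 1).
have := psi'_1 _ _ _ IH; rewrite !Zgrp_mulE -addn1 PoszD opprD zpowN1.
by rewrite -!addrA !(addrCA (-1)).
Qed.

Lemma zpow_aut (n : Zgrp) : is_kalg_aut mul (zpow n).
Proof.
split; last by exists (zpow (- n)) => x; rewrite -zpowD ?addNr ?addrN.
case: n => m; apply: kalg_morph_iter => //.
exact: (kalg_morph_can Hpsi psiK psi'K).
Qed.

Lemma Zalg_principal : principal mul one.
Proof.
exact: (graded_action_principal HR zpow_aut zpowD zpow_graded).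
Qed.

End IntAction.

Theorem proposition3p1 :
  (* General G: R principal <-> there is a group monomorphism
     T : G -> Aut_*(R) with T_g of left degree g (R assumed nonzero, see NOTES). *)
  (forall (k : comPzRingType) (G : groupType) (R : lmodType k)
          (mulR : R -> R -> R) (C : G -> G -> pred R) (oneR : G -> R),
     is_Galgebra mulR C oneR ->
     (exists x : R, x != 0) ->
     (principal mulR oneR <->
      exists T : G -> R -> R,
        [/\ (forall g, is_kalg_aut mulR (T g)),
            (forall g h x, T (g * h)%g x = T g (T h x)),
            (forall g h, (forall x, T g x = T h x) -> g = h) &
            (forall g, graded_of_degree C C (T g) g)])) /\
  (* Z-algebras: R principal <-> R has a k-algebra automorphism of degree 1. *)
  (forall (k : comPzRingType) (R : lmodType k)
          (mulR : R -> R -> R) (C : Zgrp -> Zgrp -> pred R) (oneR : Zgrp -> R),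
     is_Galgebra mulR C oneR ->
     (principal mulR oneR <->
      exists psi : R -> R,
        is_kalg_aut mulR psi /\ graded_of_degree C C psi Zgrp_one)).
Proof.
split=> [k G R mul C one HR nz|k R mul C one HR]; split.
- case/(principal_graded_action HR) => T [T_aut TM T_graded].
  exists T; split=> // g h Tgh; have [T_morph /bij_inj T_inj] := T_aut g.
  apply: (graded_degree_unique HR T_morph (T_graded g) nz T_inj) => f f' x xC.
  by rewrite Tgh; apply: T_graded.
- by case=> T [T_aut TM _ T_graded]; exact: (graded_action_principal HR T_aut TM T_graded).
- by case/(principal_graded_action HR) => T [T_aut _ T_graded]; exists (T Zgrp_one).
- case=> psi [[Hpsi [psi' psiK psi'K]] psi_1].
  exact: (Zalg_principal HR Hpsi psi_1 psiK psi'K).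
Qed.
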